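(* Let $\nu$ be a positive measure with support on the unit circle $\mathbb{T}$ verifying $\lim_{n\to\infty}\lambda_n(\nu)>0$, and let $\nu=\nu_a+\nu_s$ be the Lebesgue decomposition of $\nu$ ($\nu_a$ absolutely continuous and $\nu_s$ singular with respect to Lebesgue measure on $\mathbb{T}$). Assume that $\operatorname{Lim}(\mathbf{B}(\nu))=\operatorname{Lim}(\mathbf{B}(\nu_a))$, i.e. $\lim_{n\to\infty}b_{n-k,n}(\nu)=\lim_{n\to\infty}b_{n-k,n}(\nu_a)$ for every $k\in\mathbb{N}_0$. Then $\mathbf{A}(\nu)=\mathbf{A}(\nu_a)$.
   Context: For a positive Borel measure $\sigma$ on $\mathbb{T}$, $\mathbf{T}(\sigma)=(c_{i,j})_{i,j=0}^\infty$ with $c_{i,j}=\int z^i\overline{z}^j\,d\sigma$ is its moment matrix and $\lambda_n(\sigma)$ is the smallest eigenvalue of $(c_{i,j})_{i,j=0}^n$. When all truncations have positive determinant, $P_n(z)=\sum_{k=0}^n b_{k,n}(\sigma)z^k$, $b_{n,n}(\sigma)>0$, are the orthonormal polynomials in $L^2(\sigma)$, and $\mathbf{B}(\sigma)=(b_{k,n}(\sigma))_{k,n=0}^\infty$ ($b_{k,n}=0$ for $k>n$) is the transition matrix. $\mathbf{A}(\sigma)=\overline{\mathbf{B}(\sigma)}\mathbf{B}(\sigma)^t$ is the formal product with entries $\sum_{k\ge\max\{i,j\}}\overline{b_{i,k}}\,b_{j,k}$, existing when these series converge. For an infinite matrix $(a_{i,j})$ such that $\alpha_k=\lim_{n\to\infty}a_{n,n+k}$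 exists for every $k\in\mathbb{Z}$ (weakly asymptotic Toeplitz), $\operatorname{Lim}((a_{i,j}))=(\alpha_{j-i})_{i,j=0}^\infty$. $\mathbb{N}_0=\{0,1,2,\dots\}$. *)

(* Defs.v *)
From HB Require Import structures.
From mathcomp Require Import all_boot all_order all_algebra.
From mathcomp Require Import complex.
From mathcomp Require Import all_classical all_reals all_analysis.

Set Implicit Arguments.
Unset Strict Implicit.
Unset Printing Implicit Defensive.

Import Order.TTheory GRing.Theory Num.Theory.
Import numFieldNormedType.Exports.

Local Open Scope classical_set_scope.
Local Open Scope ring_scope.
Local Open Scope complex_scope.

(* The complex plane carrying the measures is R * R with the product (= Borel)
   sigma-algebra; [toC] identifies it with R[i], on which the algebra and the
   limits are done. *)
Notation plane R := (measurableTypeR R * measurableTypeR R)%type.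

Definition toC (R : realType) (z : plane R) : R[i] := z.1 +i* z.2.

Definition circle (R : realType) : set (plane R) :=
  [set z | `|toC z| = 1].

Definition cis (R : realType) (t : R) : plane R := (cos t, sin t).

(* Normalized arc length, as a set function on the plane. *)
Definition circle_measure (R : realType) (A : set (plane R)) : \bar R :=
  let I : set R := [set` `[0, 2 * pi[ ] in
  (((2 * pi)^-1)%:E * lebesgue_measure (I `&` @cis R @^-1` A))%E.

Definition mutually_singular d (T : measurableType d) (R : realType)
    (m1 m2 : set T -> \bar R) : Prop :=
  exists N : set T, [/\ measurable N, m1 N = 0%E & m2 (~` N) = 0%E].

Definition lebesgue_decomposition (R : realType)
    (nu nu_a nu_s : {finite_measure set (plane R) -> \bar R}) : Prop :=
  [/\ forall A, measurable A -> nu A = (nu_a A + nu_s A)%E,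
      nu_a `<< @circle_measure R
    & mutually_singular nu_s (@circle_measure R)].

(* The library's integral is real-valued: integrate the two parts. *)
Definition Cintegral d (T : measurableType d) (R : realType)
    (m : {measure set T -> \bar R}) (D : set T) (f : T -> R[i]) : R[i] :=
  Rintegral m D (fun z => complex.Re (f z)) +i* Rintegral m D (fun z => complex.Im (f z)).

Section transition_matrix.
Variables (R : realType) (sigma : {finite_measure set (plane R) -> \bar R}).

Definition moment (i j : nat) : R[i] :=
  Cintegral sigma (@circle R) (fun z => toC z ^+ i * (toC z)^* ^+ j).

Definition moment_trunc (n : nat) : 'M[R[i]]_n.+1 :=
  \matrix_(i < n.+1, j < n.+1) moment i j.

(* The set of eigenvalues is finite, nonempty and real since the matrix is
   Hermitian, so its infimum is a minimum. *)
Definition lambda_min (n : nat) : R :=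
  inf [set r : R | eigenvalue (moment_trunc n) r%:C].

Definition is_orthonormal (P : nat -> {poly R[i]}) : Prop :=
  (forall n, size (P n) = n.+1 /\ 0 < lead_coef (P n)) /\
  (forall n m, Cintegral sigma (@circle R)
     (fun z => (P n).[toC z] * ((P m).[toC z])^*) = (n == m)%:R).

(* Exists, and is then unique, when every [moment_trunc n] has positive
   determinant. *)
Definition orthonormal_poly : nat -> {poly R[i]} :=
  xget (fun=> 0) [set P | is_orthonormal P].

Definition transition_mx (k n : nat) : R[i] := (orthonormal_poly n)`_k.

Definition formal_product_summand (i j k : nat) : R[i] :=
  (transition_mx i k)^* * transition_mx j k.

Definition formal_product_partial (i j n : nat) : R[i]^o :=
  \sum_(maxn i j <= k < n) formal_product_summand i j k.

Definition formal_product_exists : Prop :=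
  forall i j, cvgn (formal_product_partial i j).

Definition formal_product (i j : nat) : R[i] :=
  limn (formal_product_partial i j).

End transition_matrix.

Section asymptotic_toeplitz.
Variables (R : realType) (a : nat -> nat -> R[i]).

(* For k < 0 the finitely many n < -k, where n + k is not an index, get an
   irrelevant value. *)
Definition diag_entry (k : int) (n : nat) : R[i]^o := a n `|(n%:Z + k)%R|%N.

Definition weakly_asymptotic_toeplitz : Prop :=
  forall k : int, cvgn (diag_entry k).

Definition Lim (i j : nat) : R[i] := limn (diag_entry (j%:Z - i%:Z)).

End asymptotic_toeplitz.

(* Main.v *)
Require Import Defs.
From HB Require Import structures.
From mathcomp Require Import all_boot all_order all_algebra.
From mathcomp Require Import complex.
From mathcomp Require Import all_classical all_reals all_analysis.
Import Order.TTheory GRing.Theory Num.Theory.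
Import numFieldNormedType.Exports measurable_realfun.
Local Open Scope classical_set_scope.
Local Open Scope ring_scope.

Set Implicit Arguments.
Unset Strict Implicit.
Unset Printing Implicit Defensive.

(** Write b_(k,n) for the coefficient of z^k in the orthonormal polynomial P_n
    of a measure on the circle.  The partial sums of the entry (i,j) of the
    formal product are the coefficients of the reproducing (Christoffel)
    kernels K_n(z,w) = sum_(k < n) P_k(z) (P_k(w))^*, and the Christoffel-Darboux
    identity ties K_(n+1) to K_n through the last polynomial alone:

      K_(n+1)(z,w) - z w^* K_n(z,w) = P_n^#(z) (P_n^#(w))^*,

    where P_n^# is the reversed polynomial, with coefficients b_(n-i,n)^*.
    Comparing coefficients, the n+1-st partial sum of the entry (i,j) is the
    n-th partial sum of the entry (i-1,j-1), which is 0 when i = 0 or j = 0,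
    plus b_(n-i,n) b_(n-j,n)^* ([transition_mx_recE]).  If the diagonals of the
    transition matrix converge, b_(n-i,n) --> a_i, then induction along the
    diagonal of (i,j) gives the convergence of every partial sum, with limit

      sum_(l <= min(i,j)) a_(i-l) a_(j-l)^*

    ([formal_product_partial_cvg]).  So the formal product exists and depends
    on the limits a_i only, and two measures with the same Lim have the same
    formal product.

    The Christoffel-Darboux identity compares two orthonormal bases, for
    sigma, of the polynomials of degree at most n: the P_0, ..., P_n, and
    X P_0, ..., X P_(n-1), P_n^#.  The second is orthonormal because
    multiplication by X is an isometry on the circle ([moment_toeplitz]), and
    so is reversal up to conjugation ([gram_form_reverse]).  Orthonormal bases
    of the same space have the same kernel ([gram_kernel_unique]).  If there
    is no orthonormal sequence, the transition matrix is 0 and both sides of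
    the recurrence vanish. *)

(** * The Christoffel-Darboux recurrence for a Hermitian Toeplitz form *)

Section ToeplitzGram.
Variables (K : fieldType) (cj : {rmorphism K -> K}).
Hypothesis cjK : involutive cj.
Variable G : nat -> nat -> K.

(** The sesquilinear form with matrix [G] on polynomials of degree less than
    [N], these being given by their coefficient sequences. *)
Definition gram_form N (f g : nat -> K) : K :=
  \sum_(i < N) \sum_(j < N) f i * cj (g j) * G i j.

(** [u i k] is the coefficient of degree [i] of the [k]-th vector, as in a
    transition matrix. *)
Definition gram_orthonormal N (u : nat -> nat -> K) :=
  forall k l, (k < N)%N -> (l < N)%N ->
    gram_form N (u^~ k) (u^~ l) = (k == l)%:R.

(** With the vectors as rows of M, orthonormality reads M H M^* = 1, hence
    M^* M = H^-1, and the left-hand side is the matrix of the kernel: it does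
    not depend on the orthonormal basis. *)
Lemma gram_kernel_unique N (u v : nat -> nat -> K) :
  gram_orthonormal N u -> gram_orthonormal N v ->
  forall i j, (i < N)%N -> (j < N)%N ->
    \sum_(k < N) cj (u i k) * u j k = \sum_(k < N) cj (v i k) * v j k.
Proof.
move=> ou ov i j iN jN.
pose M (w : nat -> nat -> K) : 'M[K]_N := \matrix_(k, l) w l k.
pose H : 'M[K]_N := \matrix_(k, l) G k l.
have MH w : gram_orthonormal N w ->
    H *m (map_mx cj (M w)^T *m M w) = 1%:M.
  move=> ow; rewrite mulmxA; apply: mulmx1C; rewrite mulmxA.
  apply/matrixP => k l; rewrite !mxE -(ow k l)//.
  rewrite /gram_form exchange_big; apply: eq_bigr => q _ /=.
  rewrite !mxE mulr_suml; apply: eq_bigr => p _.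
  by rewrite !mxE mulrAC.
have E : map_mx cj (M u)^T *m M u = map_mx cj (M v)^T *m M v.
  by rewrite -[LHS]mul1mx -(mulmx1C (MH v ov)) -mulmxA (MH u ou) mulmx1.
move/matrixP/(_ (Ordinal iN) (Ordinal jN)): E; rewrite !mxE => E.
have -> : \sum_(k < N) cj (u i k) * u j k =
  \sum_j0 (map_mx cj (M u)^T) (Ordinal iN) j0 * M u j0 (Ordinal jN).
  by apply: eq_bigr => k _; rewrite !mxE.
by rewrite E; apply: eq_bigr => k _; rewrite !mxE.
Qed.

Hypothesis GS : forall i j, G i.+1 j.+1 = G i j.
Hypothesis GC : forall i j, cj (G i j) = G j i.

(** Multiplication of a polynomial by the indeterminate. *)
Definition shift_coef (f : nat -> K) (i : nat) : K :=
  if i is i'.+1 then f i' else 0.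

(** The reversed polynomial z^n (f(1/z^* ))^*. *)
Definition reverse_coef n (f : nat -> K) (i : nat) : K := cj (f (n - i)%N).

Lemma gram_formC N f g : cj (gram_form N f g) = gram_form N g f.
Proof.
rewrite /gram_form rmorph_sum exchange_big; apply: eq_bigr => i _ /=.
rewrite rmorph_sum; apply: eq_bigr => j _.
by rewrite !rmorphM GC cjK (mulrC (cj _)).
Qed.

Lemma gram_form_shift N f g :
  gram_form N.+1 (shift_coef f) (shift_coef g) = gram_form N f g.
Proof.
rewrite /gram_form big_ord_recl big1 ?add0r => [|j _]; last by rewrite !mul0r.
apply: eq_bigr => i _; rewrite big_ord_recl /= rmorph0 mulr0 mul0r add0r.
by apply: eq_bigr => j _; rewrite GS.
Qed.

Lemma toeplitz_addr k i j : G (i + k)%N (j + k)%N = G i j.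
Proof. by elim: k => [|k IH]; rewrite ?addn0 // !addnS GS. Qed.

(** Both sides have the same difference of indices. *)
Lemma toeplitz_reverse n i j : (i <= n)%N -> (j <= n)%N ->
  G (n - i)%N (n - j)%N = G j i.
Proof.
move=> ile jle.
have Ei : (n - i + (i + j) = j + n)%N by rewrite addnA subnK // addnC.
have Ej : (n - j + (i + j) = i + n)%N by rewrite (addnC i) addnA subnK // addnC.
by rewrite -[LHS](toeplitz_addr (i + j)) Ei Ej toeplitz_addr.
Qed.

(** Reversal is an antiunitary involution of the polynomials of degree at most
    [n], here in the form in which one of its two instances is moved across. *)
Lemma gram_form_reverse n f g :
  gram_form n.+1 f (reverse_coef n g) = gram_form n.+1 g (reverse_coef n f).
Proof.
rewrite /gram_form (reindex_inj rev_ord_inj) exchange_big.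
rewrite (reindex_inj rev_ord_inj); apply: eq_bigr => i _ /=.
apply: eq_bigr => j _ /=; rewrite /reverse_coef !cjK !subSS.
rewrite subKn ?leq_ord //.
by rewrite toeplitz_reverse ?leq_ord // (mulrC (f _)).
Qed.

Variable b : nat -> nat -> K.
Hypothesis b_lower : forall k n, (n < k)%N -> b k n = 0.
Hypothesis b_diag : forall n, b n n != 0.
Hypothesis b_orth : forall N, gram_orthonormal N b.

Lemma gram_form_ext N f f' g g' : (forall i, (i < N)%N -> f i = f' i) ->
  (forall i, (i < N)%N -> g i = g' i) -> gram_form N f g = gram_form N f' g'.
Proof.
move=> ff' gg'; apply: eq_bigr => i _; apply: eq_bigr => j _.
by rewrite ff' ?gg'.
Qed.

(** The functional v = <b_n, .> kills b_0, ..., b_(n-1); as these have nonzero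
    leading coefficients, it kills the monomials of degree < n one after the
    other. *)
Lemma orthogonal_lower_degree n g : g n = 0 -> gram_form n.+1 (b^~ n) g = 0.
Proof.
move=> gn.
pose v j := \sum_(i < n.+1) b i n * G i j.
have formE h : gram_form n.+1 (b^~ n) h = \sum_(j < n.+1) cj (h j) * v j.
  rewrite /gram_form exchange_big; apply: eq_bigr => j _ /=.
  by rewrite mulr_sumr; apply: eq_bigr => i _; rewrite mulrCA mulrA.
have v0 j : (j < n)%N -> v j = 0.
  elim/ltn_ind: j => j IH jn.
  have := b_orth (ltnSn n) (ltnW jn : (j < n.+1)%N).
  rewrite formE (bigD1 (Ordinal (ltnW jn : (j < n.+1)%N))) //= gtn_eqF //.
  rewrite big1 ?addr0 => [/eqP|i].
    by rewrite mulf_eq0 fmorph_eq0 (negbTE (b_diag j)) => /eqP.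
  rewrite -val_eqE /= neq_ltn => /orP[ij|ji].
    by rewrite IH ?mulr0 // (ltn_trans ij).
  by rewrite b_lower // rmorph0 mul0r.
rewrite formE big_ord_recr /= gn rmorph0 mul0r addr0 big1 // => j _.
by rewrite v0 ?mulr0.
Qed.

Definition kernel_coef n i j : K := \sum_(k < n) cj (b i k) * b j k.

(** The Christoffel-Darboux identity, read on coefficients: the kernel of degree
    [n] computed in the orthonormal basis X P_0, ..., X P_(n-1), P_n^#. *)
Lemma kernel_coef_recE n i j : (i <= n)%N -> (j <= n)%N ->
  kernel_coef n.+1 i j =
    \sum_(k < n) cj (shift_coef (b^~ k) i) * shift_coef (b^~ k) j
    + b (n - i)%N n * cj (b (n - j)%N n).
Proof.
move=> ile jle.
pose c i k :=
  if (k < n)%N then shift_coef (b^~ k) i else reverse_coef n (b^~ n) i.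
(* Moving the reversal across turns the multiple of X into a polynomial without
   term of degree n, to which P_n is orthogonal. *)
have shift_rev k : (k < n)%N ->
    gram_form n.+1 (shift_coef (b^~ k)) (reverse_coef n (b^~ n)) = 0.
  move=> kn; rewrite gram_form_reverse orthogonal_lower_degree //.
  by rewrite /reverse_coef subnn /= rmorph0.
have oc : gram_orthonormal n.+1 c.
  move=> k l; rewrite !ltnS /c leq_eqVlt => /predU1P[->|kn];
    rewrite leq_eqVlt => /predU1P[->|ln].
  - rewrite ltnn eqxx gram_form_reverse.
    have := b_orth (ltnSn n) (ltnSn n); rewrite eqxx => <-.
    by apply: gram_form_ext => // p pn; rewrite /reverse_coef cjK subKn.
  - by rewrite ltnn ln -gram_formC shift_rev // rmorph0 gtn_eqF.
  - by rewrite ltnn kn shift_rev // ltn_eqF.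
  - by rewrite kn ln gram_form_shift b_orth.
rewrite /kernel_coef (gram_kernel_unique (@b_orth n.+1) oc) ?ltnS //.
have cn p : c p n = cj (b (n - p)%N n) by rewrite /c ltnn.
rewrite big_ord_recr /= !cn cjK; congr (_ + _).
by apply: eq_bigr => k _; rewrite /c ltn_ord.
Qed.

End ToeplitzGram.

(** * Linearity of the complex integral *)

Section ComplexIntegral.
Local Open Scope complex_scope.
Context d (T : measurableType d) (R : realType).
Variables (m : {measure set T -> \bar R}) (D : set T).
Hypothesis mD : measurable D.

(** Matches [Cintegral], which integrates the two parts separately. *)
Definition Cintegrable (f : T -> R[i]) :=
  m.-integrable D (EFin \o (fun z => complex.Re (f z))) /\
  m.-integrable D (EFin \o (fun z => complex.Im (f z))).

Lemma Re_mulc (x y : R[i]) : complex.Re (x * y) =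
  complex.Re x * complex.Re y - complex.Im x * complex.Im y.
Proof. by case: x y => [a b] [a' b']. Qed.

Lemma Im_mulc (x y : R[i]) : complex.Im (x * y) =
  complex.Re x * complex.Im y + complex.Im x * complex.Re y.
Proof. by case: x y => [a b] [a' b']. Qed.

Lemma eq_Cintegral (f g : T -> R[i]) :
  {in D, f =1 g} -> Cintegral m D f = Cintegral m D g.
Proof.
by move=> fg; congr (_ +i* _); apply: eq_Rintegral => z zD; rewrite fg.
Qed.

Lemma Cintegral0 : Cintegral m D (fun=> 0) = 0.
Proof. by rewrite /Cintegral /Rintegral !integral0. Qed.

Lemma Cintegrable0 : Cintegrable (fun=> 0).
Proof. by split; exact: integrable0. Qed.

Lemma CintegrableD f g : Cintegrable f -> Cintegrable g ->
  Cintegrable (fun z => f z + g z).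
Proof.
move=> [f1 f2] [g1 g2]; split.
- apply: eq_integrable (integrableD mD f1 g1) => // z _ /=.
  by rewrite raddfD EFinD.
- apply: eq_integrable (integrableD mD f2 g2) => // z _ /=.
  by rewrite raddfD EFinD.
Qed.

Lemma CintegralD f g : Cintegrable f -> Cintegrable g ->
  Cintegral m D (fun z => f z + g z) = Cintegral m D f + Cintegral m D g.
Proof.
move=> [f1 f2] [g1 g2]; rewrite /Cintegral.
by congr (_ +i* _); rewrite -RintegralD //; apply: eq_Rintegral => z _;
  rewrite raddfD.
Qed.

Lemma CintegrableZl c f : Cintegrable f -> Cintegrable (fun z => c * f z).
Proof.
move=> [f1 f2]; split.
- apply: eq_integrable (integrableB mD (integrableZl mD (complex.Re c) f1)
    (integrableZl mD (complex.Im c) f2)) => // z _ /=.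
  by rewrite Re_mulc.
- apply: eq_integrable (integrableD mD (integrableZl mD (complex.Re c) f2)
    (integrableZl mD (complex.Im c) f1)) => // z _ /=.
  by rewrite Im_mulc.
Qed.

Lemma CintegralZl c f : Cintegrable f ->
  Cintegral m D (fun z => c * f z) = c * Cintegral m D f.
Proof.
move=> [f1 f2]; rewrite /Cintegral.
have intZ (r : R) (h : T -> R) : m.-integrable D (EFin \o h) ->
    m.-integrable D (EFin \o (fun z => r * h z)).
  by move=> ih; apply: eq_integrable (integrableZl mD r ih).
apply/eqP; rewrite eq_complex Re_mulc Im_mulc /=; apply/andP; split; apply/eqP.
- rewrite -!RintegralZl // -RintegralB //; try exact: intZ.
  by apply: eq_Rintegral => z _; rewrite Re_mulc.
- rewrite -!RintegralZl // -RintegralD //; try exact: intZ.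
  by apply: eq_Rintegral => z _; rewrite Im_mulc.
Qed.

Lemma Cintegrable_sum (I : Type) (s : seq I) (F : I -> T -> R[i]) :
  (forall i, Cintegrable (F i)) -> Cintegrable (fun z => \sum_(i <- s) F i z).
Proof.
move=> iF; elim: s => [|i s IH].
  by under eq_fun do rewrite big_nil; exact: Cintegrable0.
by under eq_fun do rewrite big_cons; exact: CintegrableD.
Qed.

Lemma Cintegral_sum (I : Type) (s : seq I) (F : I -> T -> R[i]) :
  (forall i, Cintegrable (F i)) ->
  Cintegral m D (fun z => \sum_(i <- s) F i z) =
  \sum_(i <- s) Cintegral m D (F i).
Proof.
move=> iF; elim: s => [|i s IH].
  by rewrite big_nil; under eq_fun do rewrite big_nil; exact: Cintegral0.
rewrite big_cons -IH -CintegralD //; last exact: Cintegrable_sum.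
by congr Cintegral; apply/funext => z; rewrite big_cons.
Qed.

Lemma Cintegral_conj f : Cintegrable f ->
  Cintegral m D (fun z => (f z)^*%C) = (Cintegral m D f)^*%C.
Proof.
move=> [_ f2]; rewrite /Cintegral /=; congr (_ +i* _).
  by apply: eq_Rintegral => z _; case: (f z).
rewrite -mulN1r -RintegralZl //.
by apply: eq_Rintegral => z _; rewrite mulN1r; case: (f z).
Qed.

End ComplexIntegral.

(** * Moments of a measure on the circle *)

Section CircleMoments.
Local Open Scope complex_scope.
Variable R : realType.

Definition Cmeasurable (f : plane R -> R[i]) :=
  measurable_fun setT (fun z => complex.Re (f z)) /\
  measurable_fun setT (fun z => complex.Im (f z)).

Lemma Cmeasurable_toC : Cmeasurable (@toC R).
Proof. by split; [exact: measurable_fst|exact: measurable_snd]. Qed.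

Lemma Cmeasurable_conj f : Cmeasurable f -> Cmeasurable (fun z => (f z)^*%C).
Proof.
move=> [f1 f2]; split.
  by rewrite (_ : (fun z => _) = fun z => complex.Re (f z)) //;
    apply/funext => z; case: (f z).
rewrite (_ : (fun z => _) = fun z => - complex.Im (f z)).
  exact: measurableT_comp.
by apply/funext => z; case: (f z).
Qed.

Lemma Cmeasurable_mul f g :
  Cmeasurable f -> Cmeasurable g -> Cmeasurable (fun z => f z * g z).
Proof.
move=> [f1 f2] [g1 g2]; split.
- under eq_fun do rewrite Re_mulc.
  by apply: measurable_funB; exact: measurable_funM.
- under eq_fun do rewrite Im_mulc.
  by apply: measurable_funD; exact: measurable_funM.
Qed.

Lemma Cmeasurable_exp f n : Cmeasurable f -> Cmeasurable (fun z => f z ^+ n).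
Proof.
move=> mf; elim: n => [|n IH].
  by split; exact: measurable_cst.
by under eq_fun do rewrite exprS; exact: Cmeasurable_mul.
Qed.

Lemma mulJ_circle (z : plane R) : @circle R z -> toC z * (toC z)^*%C = 1.
Proof. by move=> zc; rewrite -[_ * _]normCK zc expr1n. Qed.

Lemma measurable_circle : measurable (@circle R).
Proof.
rewrite (_ : @circle R = (fun z : plane R => z.1 ^+ 2 + z.2 ^+ 2) @^-1` [set 1]).
  rewrite -[X in measurable X]setTI.
  have mf : measurable_fun setT (fun z : plane R => z.1 ^+ 2 + z.2 ^+ 2).
    apply: measurable_funD; apply: measurable_funX.
      exact: measurable_fst.
    exact: measurable_snd.
  by apply: mf => //; exact: measurable_set1.
apply/seteqP; split=> z; rewrite /circle /= => zc.
  have := add_Re2_Im2 (toC z); rewrite zc expr1n => /(congr1 (@complex.Re R)).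
  by [].
by rewrite normc_def /= zc sqrtr1.
Qed.

Variable sigma : {finite_measure set (plane R) -> \bar R}.

Lemma Cintegrable_monomial i j :
  Cintegrable sigma (@circle R) (fun z => toC z ^+ i * (toC z)^*%C ^+ j).
Proof.
have [m1 m2] : Cmeasurable (fun z => toC z ^+ i * (toC z)^*%C ^+ j).
  apply: Cmeasurable_mul; apply: Cmeasurable_exp; last apply: Cmeasurable_conj;
    exact: Cmeasurable_toC.
have n1 z : @circle R z -> `|toC z ^+ i * (toC z)^*%C ^+ j| = 1.
  by move=> zc; rewrite normrM !normrX (norm_conjC (toC z)) zc !expr1n mulr1.
have fin : (sigma (@circle R) < +oo)%E.
  rewrite -ge0_fin_numE //; apply: fin_num_measure; exact: measurable_circle.
split; apply: measurable_bounded_integrable => //;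
  try exact: measurable_circle; try exact: measurable_funTS.
- exists 1; split; rewrite ?num_real // => x x1 z zc /=.
  apply: le_trans (ltW x1); rewrite -lecR; apply: le_trans (normc_ge_Re _) _.
  by rewrite n1.
- exists 1; split; rewrite ?num_real // => x x1 z zc /=.
  apply: le_trans (ltW x1); rewrite -lecR.
  (* Only the real part is compared with the norm: rotate by 'i. *)
  have := normc_ge_Re ((toC z ^+ i * (toC z)^*%C ^+ j) * 'i).
  rewrite ReiNIm normrN normrM n1 // mul1r normc_def /=.
  by rewrite expr0n expr1n add0r sqrtr1.
Qed.

Lemma moment_conj i j : (moment sigma i j)^*%C = moment sigma j i.
Proof.
rewrite /moment -Cintegral_conj; first last.
- exact: Cintegrable_monomial.
- exact: measurable_circle.
apply: eq_Cintegral => z _; rewrite rmorphM !rmorphXn mulrC.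
by congr (_ ^+ _ * _); exact: conjcK.
Qed.

(** Multiplication by z preserves the inner product, as z z^* = 1 on the
    circle. *)
Lemma moment_toeplitz i j : moment sigma i.+1 j.+1 = moment sigma i j.
Proof.
apply: eq_Cintegral => z; rewrite inE => /mulJ_circle zc.
by rewrite !exprS mulrACA zc mul1r.
Qed.

(** The inner product of L^2(sigma), restricted to polynomials, is the form of
    the moment matrix; this brings orthonormal polynomials under the algebraic
    recurrence. *)
Lemma Cintegral_poly N (p q : {poly R[i]}) : (size p <= N)%N -> (size q <= N)%N ->
  Cintegral sigma (@circle R) (fun z => p.[toC z] * (q.[toC z])^*%C) =
  gram_form (@conjc R) (moment sigma) N (nth 0 p) (nth 0 q).
Proof.
move=> sp sq.
have intZ i j : Cintegrable sigma (@circle R)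
    (fun z => p`_i * (q`_j)^*%C * (toC z ^+ i * (toC z)^*%C ^+ j)).
  apply: CintegrableZl; [exact: measurable_circle|exact: Cintegrable_monomial].
transitivity (Cintegral sigma (@circle R) (fun z => \sum_(i < N) \sum_(j < N)
    p`_i * (q`_j)^*%C * (toC z ^+ i * (toC z)^*%C ^+ j))).
  apply: eq_Cintegral => z _; rewrite (horner_coef_wide _ sp).
  rewrite (horner_coef_wide _ sq) rmorph_sum mulr_suml.
  apply: eq_bigr => i _; rewrite mulr_sumr; apply: eq_bigr => j _ /=.
  by rewrite rmorphM rmorphXn /= mulrACA.
rewrite Cintegral_sum; first last.
- by move=> i; apply: Cintegrable_sum => //; exact: measurable_circle.
- exact: measurable_circle.
apply: eq_bigr => i _; rewrite Cintegral_sum //; last exact: measurable_circle.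
apply: eq_bigr => j _; rewrite CintegralZl //; first exact: measurable_circle.
exact: Cintegrable_monomial.
Qed.

End CircleMoments.

(** * Limits of the partial sums of the formal product *)

Section TransitionMatrix.
Local Open Scope complex_scope.
Variables (R : realType) (sigma : {finite_measure set (plane R) -> \bar R}).
Let b := transition_mx sigma.

Lemma transition_mx_lower k n : (n < k)%N -> b k n = 0.
Proof.
rewrite /b /transition_mx /orthonormal_poly => nk.
case: xgetP => [P _ [degP _]|_]; last by rewrite coef0.
by rewrite nth_default // (degP n).1.
Qed.

(** The Christoffel-Darboux recurrence for the transition matrix; its first
    term is the partial sum of the entry (i-1,j-1). *)
Lemma transition_mx_recE n i j : (i <= n)%N -> (j <= n)%N ->
  kernel_coef (@conjc R) b n.+1 i j =
    \sum_(k < n) (shift_coef (b^~ k) i)^*%C * shift_coef (b^~ k) j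
    + b (n - i)%N n * (b (n - j)%N n)^*%C.
Proof.
have [[P oP]|noP] := pselect (exists P, is_orthonormal sigma P).
  have [degP orthP] : is_orthonormal sigma (orthonormal_poly sigma).
    by apply: (@xgetPex _ _ [set Q | is_orthonormal sigma Q]); exists P.
  apply: (@kernel_coef_recE _ _ (@conjcK R) (moment sigma)) => //.
  - exact: moment_toeplitz.
  - exact: moment_conj.
  - exact: transition_mx_lower.
  - move=> k; have [sP] := degP k; rewrite /lead_coef sP /= => P0.
    exact: lt0r_neq0.
  - move=> N k l kN lN; rewrite -(orthP k l) (@Cintegral_poly _ _ N) //.
      by rewrite (degP k).1.
    by rewrite (degP l).1.
have b0 k l : b k l = 0.
  rewrite /b /transition_mx /orthonormal_poly xgetPN ?coef0 // => P oP.
  by apply: noP; exists P.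
move=> _ _; rewrite [b (n - i)%N n]b0 mul0r addr0 /kernel_coef !big1 // => k _.
  by case: j => [|j]; rewrite /= ?[b j k]b0 ?[b _ k]b0 ?mulr0.
by rewrite [b j k]b0 mulr0.
Qed.

(** The terms of index < max(i,j) vanish, so the summation may start at 0. *)
Lemma formal_product_partialE i j n :
  formal_product_partial sigma i j n = kernel_coef (@conjc R) b n i j.
Proof.
rewrite /kernel_coef -(big_mkord xpredT (fun k => (b i k)^*%C * b j k)).
case: (leqP (maxn i j) n) => [mn|nm]; last first.
  rewrite /formal_product_partial (big_geq (ltnW nm)) big_nat_cond big1 //.
  move=> k /andP[/andP[_ kn] _]; move: (ltn_trans kn nm); rewrite leq_max.
  by case/orP => kl; rewrite (transition_mx_lower kl) ?conjc0 ?mul0r ?mulr0.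
rewrite [RHS](big_cat_nat (leq0n _) mn) /= big_nat_cond big1 ?add0r // => k.
rewrite leq_max => /andP[/orP[] kl _];
  by rewrite (transition_mx_lower kl) ?conjc0 ?mul0r ?mulr0.
Qed.

Lemma cvg_conjc (u : nat -> R[i]^o) (l : R[i]^o) :
  u n @[n --> \oo] --> l ->
  ((u n)^*%C : R[i]^o) @[n --> \oo] --> (l^*%C : R[i]^o).
Proof.
move=> /cvgrPdist_lt ul; apply/cvgrPdist_lt => e e0.
near=> n; rewrite -rmorphB (norm_conjC (l - u n)).
by near: n; exact: ul.
Unshelve. all: by end_near. Qed.

Hypothesis b_wat : weakly_asymptotic_toeplitz b.
Let a := Lim b 0.

Lemma transition_diag_cvg i :
  (b (n - i)%N n : R[i]^o) @[n --> \oo] --> (a i : R[i]^o).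
Proof.
rewrite -(cvg_shiftn i).
suff -> : [sequence b (n + i - i)%N (n + i)%N : R[i]^o]_n =
    diag_entry b (i%:Z - 0%:Z).
  by apply: b_wat.
by apply/funext => n; rewrite /diag_entry subr0 -PoszD absz_nat /= addnK.
Qed.

(** The limit is the (i,j) entry of the Cholesky product of the lower triangular
    Toeplitz matrix of the a_i with its adjoint: each step of the recurrence up
    the diagonal contributes one term, until the border is reached. *)
Lemma formal_product_partial_cvg i j :
  formal_product_partial sigma i j n @[n --> \oo] -->
  (\sum_(l < (minn i j).+1) a (i - l)%N * (a (j - l)%N)^*%C : R[i]^o).
Proof.
have last_cvg i' j' : (b (n - i')%N n * (b (n - j')%N n)^*%C : R[i]^o)
    @[n --> \oo] --> (a i' * (a j')^*%C : R[i]^o).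
  by apply: cvgM; [|apply: cvg_conjc]; exact: transition_diag_cvg.
pose u i' j' : nat -> R[i]^o := fun n => kernel_coef (@conjc R) b n i' j'.
have -> : formal_product_partial sigma i j = u i j.
  by apply/funext => n; exact: formal_product_partialE.
(* On the first row and column the shifted sum vanishes and only the last
   polynomial contributes. *)
have border i' j' : minn i' j' = 0%N ->
  u i' j' n @[n --> \oo] -->
  (\sum_(l < (minn i' j').+1) a (i' - l)%N * (a (j' - l)%N)^*%C : R[i]^o).
  move=> m0; rewrite m0 big_ord1 !subn0 -cvg_shiftS.
  have sum0 n :
      \sum_(k < n) (shift_coef (b^~ k) i')^*%C * shift_coef (b^~ k) j' = 0.
    rewrite big1 // => k _.
    case: i' j' m0 => [|i'] [|j']; rewrite ?minnSS // => _;
      by rewrite [shift_coef _ 0%N]/= ?mulr0 // conjc0 mul0r.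
  apply: cvg_trans (last_cvg i' j'); apply: near_eq_cvg; near=> n.
  rewrite /u /= transition_mx_recE; [|by near: n; exact: nbhs_infty_ge..].
  by rewrite sum0 add0r.
elim: i j => [|i IH] [|j]; try by apply: border; rewrite ?minn0 ?min0n.
rewrite minnSS big_ord_recl !subn0 -cvg_shiftS.
apply: cvg_trans (cvgD (last_cvg i.+1 j.+1) (IH j)).
apply: near_eq_cvg; near=> n.
rewrite /u /= transition_mx_recE; first by rewrite addrC.
  by near: n; exact: nbhs_infty_ge.
by near: n; exact: nbhs_infty_ge.
Unshelve. all: by end_near. Qed.

End TransitionMatrix.

Unset Implicit Arguments.

Theorem corollary9 (R : realType)
    (nu nu_a nu_s : {finite_measure set (plane R) -> \bar R})
    (nu_circle : nu (~` @circle R) = 0%E)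
    (nu_lambda : 0 < limn (lambda_min nu))
    (nu_decomp : lebesgue_decomposition nu nu_a nu_s)
    (nu_wat : weakly_asymptotic_toeplitz (transition_mx nu))
    (nu_a_wat : weakly_asymptotic_toeplitz (transition_mx nu_a))
    (Lim_eq : Lim (transition_mx nu) = Lim (transition_mx nu_a)) :
  [/\ formal_product_exists nu, formal_product_exists nu_a
    & formal_product nu = formal_product nu_a].
Proof.
split=> [i j|i j|].
- by apply: cvgP; apply: formal_product_partial_cvg.
- by apply: cvgP; apply: formal_product_partial_cvg.
apply/funext => i; apply/funext => j.
have cvg_nu := @formal_product_partial_cvg _ _ nu_wat i j.
have cvg_nu_a := @formal_product_partial_cvg _ _ nu_a_wat i j.
rewrite /formal_product (cvg_lim (@norm_hausdorff _ _) cvg_nu).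
by rewrite (cvg_lim (@norm_hausdorff _ _) cvg_nu_a) Lim_eq.
Qed.
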